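(* Let $\mathcal{H}$ be a complex Hilbert space and let $T\in\mathcal{L}(\mathcal{H})$ be a split operator. If $\|P_{T^*}(I-T)\|<1$, then the $Q_T$-proper splitting of $T$ converges. In addition, if $P_{T^*}T$ is Hermitian and the $Q_T$-proper splitting of $T$ converges, then $\|P_{T^*}(I-T)\|<1$.
   Context: $T\in\mathcal{L}(\mathcal{H})$ is a split operator if it has closed range and $\mathcal{R}(T)\dotplus\mathcal{N}(T)=\mathcal{H}$ (direct sum, not necessarily orthogonal). $Q_T=Q_{\mathcal{R}(T)//\mathcal{N}(T)}$ is the (oblique) projection onto $\mathcal{R}(T)$ along $\mathcal{N}(T)$, and $P_{T^*}$ is the orthogonal projection onto $\mathcal{R}(T^* )$. A proper splitting of a closed range operator $T$ is a decomposition $T=U-V$ with $\mathcal{R}(U)=\mathcal{R}(T)$ and $\mathcal{N}(U)=\mathcal{N}(T)$; it converges if $\rho(U^\dagger V)<1$, where $\rho$ is the spectral radius and $U^\dagger$ the Moore-Penrose inverse. The $Q_T$-proper splitting of a split operator $T$ is $T=Q_T-V$, i.e. $V=Q_T-T$. *)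

(* Defs.v *)
(* A complex Hilbert space is a complete normed module over
   R[i], R : realType, whose norm comes from a positive definite Hermitian
   form. *)
From HB Require Import structures.
From mathcomp Require Import all_boot all_order all_algebra.
From mathcomp Require Import complex.
From mathcomp Require Import all_classical all_reals all_analysis.

Set Implicit Arguments.
Unset Strict Implicit.
Unset Printing Implicit Defensive.

Import Order.TTheory GRing.Theory Num.Theory.
Import numFieldNormedType.Exports.

Local Open Scope classical_set_scope.
Local Open Scope complex_scope.
Local Open Scope ring_scope.

(* The inner product is linear in its first argument and conjugate-linear in
   the second one, as in {dot _ for _}. *)
HB.mixin Record CompleteNormedModule_isHilbert (R : realType) H
    & CompleteNormedModule R[i] H := {
  hdot : {dot H for (@Num.conj R[i])} ;
  hdot_norm : forall x : H, hdot x x = `|x| ^+ 2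
}.

#[short(type="hilbertType")]
HB.structure Definition Hilbert (R : realType) :=
  {H of CompleteNormedModule R[i] H & CompleteNormedModule_isHilbert R H}.

Section Operators.
Variables (R : realType) (H : hilbertType R).
Implicit Types (A T U V X Q : H -> H) (M N : set H).

(* Operators are plain functions; membership in L(H) is a predicate. *)
Definition bounded_operator A : Prop := linear A /\ continuous A.

Definition kernel A : set H := A @^-1` [set 0].

(* The norm of H takes its values in R[i], on the nonnegative real axis, hence
   the real parts here and in spectral_radius. *)
Definition opnorm A : R :=
  sup [set complex.Re `|A x| | x in [set x : H | `|x| <= 1]].

Definition spectrum A : set R[i] :=
  [set l | ~ exists B : H -> H,
     [/\ bounded_operator B,
         B \o (fun x => A x - l *: x) = idfun &
         (fun x => A x - l *: x) \o B = idfun]].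

(* sup set0 = 0, so the spectral radius is 0 on the zero space. *)
Definition spectral_radius A : R :=
  sup [set complex.Re `|l| | l in spectrum A].

(* adjoint, oblique_proj and MPinverse are each given by a property that determines it
   uniquely; they are the zero map when no operator has this property. *)
Definition adjoint A : H -> H :=
  xget (cst 0) [set B | bounded_operator B /\
                        forall x y, hdot (A x) y = hdot x (B y)].

Definition hermitian_operator A : Prop := adjoint A = A.

Definition direct_sum M N : Prop :=
  M `&` N = [set 0] /\
  forall x, exists y z, [/\ M y, N z & x = y + z].

Definition oblique_proj M N : H -> H :=
  xget (cst 0) [set Q | [/\ bounded_operator Q, Q \o Q = Q,
                            range Q = M & kernel Q = N]].

Definition orth_compl M : set H :=
  [set x | forall y, M y -> hdot x y = 0].

Definition orth_proj M : H -> H := oblique_proj M (orth_compl M).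

Definition MPinverse A : H -> H :=
  xget (cst 0) [set X | bounded_operator X /\
                        [/\ A \o X \o A = A,
                            X \o A \o X = X,
                            hermitian_operator (A \o X) &
                            hermitian_operator (X \o A)]].

Definition split_operator T : Prop :=
  [/\ bounded_operator T, closed (range T) &
      direct_sum (range T) (kernel T)].

Definition split_proj T : H -> H := oblique_proj (range T) (kernel T).

Definition proper_splitting T U V : Prop :=
  closed (range T) /\
  [/\ bounded_operator U, bounded_operator V,
      T = U \- V, range U = range T & kernel U = kernel T].

Definition proper_splitting_converges T U V : Prop :=
  proper_splitting T U V /\ spectral_radius (MPinverse U \o V) < 1.

Definition split_proper_splitting_converges T : Prop :=
  proper_splitting_converges T (split_proj T) (split_proj T \- T).

End Operators.

(* Main.v *)
From Pilot Require Import Defs.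
From HB Require Import structures.
From mathcomp Require Import all_boot all_order all_algebra.
From mathcomp Require Import complex.
From mathcomp Require Import all_classical all_reals all_analysis.
From mathcomp Require Import ring lra.

(* Write P for the orthogonal projection onto R(T^* ), which is closed because
   R(T) is; thus P projects onto N(T)^perp.  Any Penrose inverse X of the oblique
   projection Q = Q_T makes X Q a Hermitian idempotent with kernel
   N(Q) = N(T), so X Q = P, and T = Q T gives X (Q - T) = P (I - T).  The theorem
   then compares the spectral radius and the norm of P (I - T): the radius is at
   most the norm, with equality for a Hermitian operator, and P (I - T) = P - P T
   is Hermitian when P T is.  The closed range estimates behind the boundedness
   of Q_T and the closedness of R(T^* ) come from uniform boundedness. *)

Set Implicit Arguments.
Unset Strict Implicit.
Unset Printing Implicit Defensive.

Import Order.TTheory GRing.Theory Num.Theory.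
Import numFieldNormedType.Exports.
Local Open Scope classical_set_scope.
Local Open Scope ring_scope.
Local Open Scope complex_scope.

(* The measure theory library also exports a [kernel]. *)
Local Notation kernel := Pilot.Defs.kernel.

(** * Real-valued norm and inner product calculus *)

Section RealNorm.
Context {R : realType} {H : hilbertType R}.
Implicit Types (x y z : H) (a : R[i]).

(** Moving norms from [R[i]] to [R] gives access to suprema and to the tactics [lra] and [nra]. *)
Definition rnorm x : R := complex.Re `|x|.

Lemma rnormE x : `|x| = (rnorm x)%:C.
Proof. by rewrite /rnorm RRe_real// ger0_real. Qed.

Lemma rnorm_ge0 x : 0 <= rnorm x.
Proof. by rewrite -ler0c -rnormE. Qed.

Lemma rnorm0 : rnorm 0 = 0.
Proof. by rewrite /rnorm normr0. Qed.

Lemma rnorm0_eq0 x : rnorm x = 0 -> x = 0.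
Proof. by move=> x0; apply/normr0_eq0; rewrite rnormE x0. Qed.

Lemma rnormN x : rnorm (- x) = rnorm x.
Proof. by rewrite /rnorm normrN. Qed.

Lemma rnormD x y : rnorm (x + y) <= rnorm x + rnorm y.
Proof. by rewrite -lecR rmorphD/= -!rnormE ler_normD. Qed.

Lemma rnormB x y : rnorm (x - y) <= rnorm x + rnorm y.
Proof. by rewrite -(rnormN y) rnormD. Qed.

Lemma rnorm_distC x y : rnorm (x - y) = rnorm (y - x).
Proof. by rewrite -rnormN opprB. Qed.

Lemma complex_normE a : `|a| = (complex.Re `|a|)%:C.
Proof. by rewrite RRe_real// ger0_real. Qed.

Lemma Re_normD (a b : R[i]) :
  complex.Re `|a + b| <= complex.Re `|a| + complex.Re `|b|.
Proof. by rewrite -lecR rmorphD/= -!complex_normE ler_normD. Qed.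

Lemma Re_norm_real (t : R) : complex.Re `|t%:C| = `|t|.
Proof. by rewrite normc_def/= expr0n addr0 sqrtr_sqr. Qed.

Lemma rnormZ a x : rnorm (a *: x) = complex.Re `|a| * rnorm x.
Proof. by apply/complexI; rewrite rmorphM/= -!rnormE normrZ -complex_normE. Qed.

Lemma rnormZR (t : R) x : rnorm (t%:C *: x) = `|t| * rnorm x.
Proof. by rewrite rnormZ Re_norm_real. Qed.

Lemma hdotC x y : hdot x y = (hdot y x)^*%C.
Proof. by rewrite hermC/= mul1r. Qed.

Lemma hdotxx x : hdot x x = (rnorm x ^+ 2)%:C.
Proof. by rewrite hdot_norm rnormE rmorphXn. Qed.

Lemma hdotDl x y z : hdot (x + y) z = hdot x z + hdot y z.
Proof. exact: linearDl. Qed.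
Lemma hdotBl x y z : hdot (x - y) z = hdot x z - hdot y z.
Proof. exact: linearBl. Qed.
Lemma hdotZl a x z : hdot (a *: x) z = a * hdot x z.
Proof. exact: linearZl_LR. Qed.
Lemma hdot0l z : hdot 0 z = 0 :> R[i].
Proof. exact: linear0l. Qed.
Lemma hdotDr x y z : hdot z (x + y) = hdot z x + hdot z y.
Proof. exact: linearDr. Qed.
Lemma hdotBr x y z : hdot z (x - y) = hdot z x - hdot z y.
Proof. exact: linearBr. Qed.
Lemma hdotZr a x z : hdot z (a *: x) = a^*%C * hdot z x.
Proof. exact: linearZr_LR. Qed.
Lemma hdot0r z : hdot z 0 = 0 :> R[i].
Proof. exact: linear0r. Qed.

Lemma hdot_eq0C x y : hdot x y = 0 -> hdot y x = 0.
Proof. by move=> xy0; rewrite hdotC xy0 conjc0. Qed.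

Lemma hdot_eq0 x : hdot x x = 0 -> x = 0.
Proof.
rewrite hdotxx => /complexI/eqP.
by rewrite expf_eq0/= => /eqP/rnorm0_eq0.
Qed.

Lemma rnormD_sqr x y :
  rnorm (x + y) ^+ 2 = rnorm x ^+ 2 + rnorm y ^+ 2 + 2 * complex.Re (hdot x y).
Proof.
have hE : hdot x y + (hdot x y)^*%C = (2 * complex.Re (hdot x y))%:C.
  by rewrite addcJ rmorphM/= rmorph_nat.
apply/complexI; rewrite -hdotxx hdotDl !hdotDr (hdotC y x) !hdotxx.
by rewrite 2!rmorphD /= -hE; ring.
Qed.

Lemma rnormB_sqr x y :
  rnorm (x - y) ^+ 2 = rnorm x ^+ 2 + rnorm y ^+ 2 - 2 * complex.Re (hdot x y).
Proof.
by rewrite rnormD_sqr rnormN -[- y]scaleN1r hdotZr rmorphN1 mulN1r raddfN mulrN.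
Qed.

Lemma parallelogram x y :
  rnorm (x + y) ^+ 2 + rnorm (x - y) ^+ 2 = 2 * (rnorm x ^+ 2 + rnorm y ^+ 2).
Proof. by rewrite rnormD_sqr rnormB_sqr; ring. Qed.

(** Subtracting from [x] its component along [y] leaves a vector whose squared norm,
    [hdot x x - |h|^2 / d], is nonnegative. *)
Lemma hdot_CauchySchwarz x y : complex.Re `|hdot x y| <= rnorm x * rnorm y.
Proof.
rewrite -lecR -complex_normE rmorphM/= -!rnormE -(@ler_pXn2r _ 2)// ?nnegrE ?mulr_ge0//.
rewrite exprMn -!hdot_norm.
have [->|y0] := eqVneq y 0; first by rewrite !hdot0r normr0 mulr0 expr0n.
set h := hdot x y; set d := hdot y y.
have d0 : 0 < d by exact: neq0_dnorm_gt0.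
have dr : d^*%C = d by rewrite /d hdotxx conjc_real.
have : 0 <= hdot (x - (h / d) *: y) (x - (h / d) *: y) by rewrite hdot_norm exprn_ge0.
rewrite hdotBl !hdotBr !hdotZl !hdotZr -/h -/d (hdotC y x) -/h rmorphM fmorphV /= dr.
rewrite -[X in _ <= X -> _](_ : hdot x x - `|h| ^+ 2 / d = _) ?subr_ge0 ?ler_pdivrMr//.
by rewrite sqr_normc; field; exact: lt0r_neq0.
Qed.

End RealNorm.

(** * Algebra of plain functions that satisfy the predicate [linear] *)

Section LinearMaps.
Context {K : pzRingType} {U V : lmodType K} {f : U -> V} (lf : linear f).

Lemma linear_map0 : f 0 = 0.
Proof. by apply/(addIr (f 0)); rewrite -{1}[f 0]scale1r -lf scale1r !add0r. Qed.

Lemma linear_mapZ a x : f (a *: x) = a *: f x.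
Proof. by rewrite -[a *: x]addr0 lf linear_map0 addr0. Qed.

Lemma linear_mapD x y : f (x + y) = f x + f y.
Proof. by rewrite -[x]scale1r lf !scale1r. Qed.

Lemma linear_mapB x y : f (x - y) = f x - f y.
Proof. by rewrite linear_mapD -scaleN1r linear_mapZ scaleN1r. Qed.

End LinearMaps.

(** * Closedness, continuity and completeness in terms of the real norm *)

Section Topology.
Context {R : realType} {H : hilbertType R}.
Implicit Types (x y z : H) (M : set H) (A B : H -> H) (u : nat -> H).

Lemma ball_rnorm x y (e : R) : ball x e%:C y <-> rnorm (x - y) < e.
Proof. by rewrite -ball_normE/= rnormE ltcR. Qed.

(** Numbers comparable in [R[i]] have equal imaginary parts, so complex radii of balls are in fact
    real. *)
Lemma gt0_complexE (e : R[i]) : 0 < e -> e = (complex.Re e)%:C /\ 0 < complex.Re e.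
Proof.
by move=> e0; rewrite -ltcR RRe_real//; exact: gtr0_real.
Qed.

Lemma nbhs_rnorm x (S : set H) :
  nbhs x S <-> exists2 e : R, 0 < e & forall y, rnorm (x - y) < e -> S y.
Proof.
split=> [/nbhs_ballP[e /= /gt0_complexE[-> e0] eS]|[e e0 eS]].
  by exists (complex.Re e) => // y /ball_rnorm/eS.
by apply/nbhs_ballP; exists e%:C; rewrite /= ?ltcR// => y /ball_rnorm/eS.
Qed.

Lemma closed_rnormP M : closed M <->
  forall x, (forall e : R, 0 < e -> exists2 y, M y & rnorm (x - y) < e) -> M x.
Proof.
split=> [clM x xM|clM x xM].
  apply: clM => S /nbhs_rnorm[e /xM[y My xye] eS].
  by exists y; split => //; exact: eS.
apply: clM => e e0; have [|y [My xye]] := xM [set y | rnorm (x - y) < e].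
  by apply/nbhs_rnorm; exists e.
by exists y.
Qed.

Lemma cvg_rnorm u x : u @ \oo --> x ->
  forall e : R, 0 < e -> exists N, forall n, (N <= n)%N -> rnorm (x - u n) < e.
Proof.
move=> ux e e0; have [|N _ NS] := ux [set y | rnorm (x - y) < e].
  by apply/nbhs_rnorm; exists e.
by exists N => n /NS.
Qed.

Lemma bounded_operator_bound A : bounded_operator A ->
  exists2 C : R, 0 <= C & forall x, rnorm (A x) <= C * rnorm x.
Proof.
move=> [lA cA]; pose f : {linear H -> H} := HB.pack A (GRing.isLinear.Build _ _ _ _ A lA).
have /linear_boundedP/pinfty_ex_gt0[r /gt0_complexE[-> r0] Ar] :=
  continuous_linear_bounded 0 (cA 0 : {for 0, continuous f}).
exists (complex.Re r); first exact: ltW.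
by move=> x; rewrite -lecR rmorphM/= -!rnormE.
Qed.

Lemma linear_bounded_operator A (C : R) : linear A ->
  (forall x, rnorm (A x) <= C * rnorm x) -> bounded_operator A.
Proof.
move=> lA AC; split => //.
pose f : {linear H -> H} := HB.pack A (GRing.isLinear.Build _ _ _ _ A lA).
suff: continuous f by [].
apply/linear_bounded_continuous/bounded_funP => r.
(* The radius [r] ranges over [R[i]]; unless it is real and nonnegative, it bounds the norm of no
   vector. *)
have [r0|r0] := boolP (0 <= r); last first.
  by exists 0 => x xr; move: r0; rewrite (le_trans _ xr).
(* [C] may be negative; the maximum makes the bound monotone in the radius. *)
exists ((Num.max C 0 * complex.Re r)%:C) => x.
rewrite -(RRe_real (ger0_real r0)) !rnormE !lecR => xr; apply: (le_trans (AC x)).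
rewrite (@le_trans _ _ (Num.max C 0 * rnorm x))//.
  by rewrite ler_wpM2r ?rnorm_ge0// le_max lexx.
by rewrite ler_wpM2l// le_max lexx orbT.
Qed.

Lemma cvg_closed M u x : closed M -> (forall n, M (u n)) -> u @ \oo --> x -> M x.
Proof.
move=> clM Mu ux; suff nearMu : \forall n \near \oo, M (u n).
  exact: (closed_cvg M clM nearMu x ux).
by apply: nearW => n; exact: Mu.
Qed.

(** A Cauchy sequence with explicit tail bounds: the limit inherits each of them, by comparison with
    a term beyond both indices. *)
Lemma rnorm_complete u (e : nat -> R) :
  (forall d, 0 < d -> exists n, e n < d) ->
  (forall n m, (n <= m)%N -> rnorm (u m - u n) <= e n) ->
  exists l, (u @ \oo --> l) /\ forall n, rnorm (l - u n) <= e n.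
Proof.
move=> e0 ue.
have : cvgn u.
  apply/cauchy_cvgP/cauchy_exP => d /gt0_complexE[-> /e0[N Nd]].
  exists (u N), N => // n /= Nn; apply/ball_rnorm.
  by rewrite rnorm_distC; apply: le_lt_trans Nd; exact: ue.
move=> /cvg_ex[l ul]; exists l; split => // n.
apply/ler_addgt0Pr => d d0; have [N /(_ (maxn N n))] := cvg_rnorm ul d0.
rewrite leq_maxl => /(_ isT)/ltW lud.
rewrite (_ : l - u n = (l - u (maxn N n)) + (u (maxn N n) - u n)); last first.
  by rewrite addrA subrK.
by rewrite [leRHS]addrC (le_trans (rnormD _ _))// lerD// ue// leq_maxr.
Qed.

End Topology.

(** * Best approximation in a closed subspace *)

Section Projection.
Context {R : realType} {H : hilbertType R}.
Implicit Types (x y z w : H) (M N : set H) (A B : H -> H).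

Definition subspace M := M 0 /\ forall a x y, M x -> M y -> M (a *: x + y).

Lemma subspaceD M x y : subspace M -> M x -> M y -> M (x + y).
Proof. by move=> [_ sM] Mx My; rewrite -[x]scale1r; exact: sM. Qed.

Lemma subspaceZ M a x : subspace M -> M x -> M (a *: x).
Proof. by move=> [M0 sM] Mx; rewrite -[_ *: _]addr0; exact: sM. Qed.

Lemma subspaceB M x y : subspace M -> M x -> M y -> M (x - y).
Proof.
move=> sM Mx My; apply: subspaceD => //.
by rewrite -scaleN1r; exact: subspaceZ.
Qed.

Lemma ler_mul_eps (r C : R) : (forall e, 0 < e -> r <= C * e) -> r <= 0.
Proof.
move=> rC; apply/ler_addgt0Pr => d d0; rewrite add0r.
have C0 : 0 < `|C| + 1 by rewrite ltr_pwDr.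
apply: (le_trans (rC (d / (`|C| + 1)) _)); first exact: divr_gt0.
rewrite mulrA ler_pdivrMr// [leRHS]mulrC ler_wpM2r ?(ltW d0)//.
by rewrite (le_trans (ler_norm C))// lerDl.
Qed.

Lemma rnorm_le_eps (C : R) x : (forall e, 0 < e -> rnorm x <= C * e) -> x = 0.
Proof.
move=> /ler_mul_eps x0; apply: rnorm0_eq0.
by apply/eqP; rewrite eq_le x0 rnorm_ge0.
Qed.

Lemma invS_lt (e : R) : 0 < e -> exists n, n.+1%:R^-1 < e.
Proof.
move=> e0; exists (Num.truncn e^-1).
by rewrite -ltf_pV2 ?posrE ?invr_gt0// invrK truncnS_gt.
Qed.

(** A sequence minimizing the distance to [x] is Cauchy by the parallelogram law; at its limit,
    perturbing along any vector of [M] cannot reduce the distance, which forces orthogonality. *)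
Lemma projection_exists M x : closed M -> subspace M ->
  exists2 y, M y & orth_compl M (x - y).
Proof.
move=> clM sM; pose E := [set rnorm (x - y) ^+ 2 | y in M].
have E_has_inf : has_inf E.
  split; first by exists (rnorm (x - 0) ^+ 2), 0 => //; exact: sM.1.
  by exists 0 => _ [y _ <-]; exact: sqr_ge0.
set D := inf E.
have DE y : M y -> D <= rnorm (x - y) ^+ 2.
  by move=> My; apply: ge_inf; [exact: E_has_inf.2|exists y].
have D0 : 0 <= D by apply: lb_le_inf; [exact: E_has_inf.1|move=> _ [y _ <-]; exact: sqr_ge0].
pose d n : R := n.+1%:R^-1.
have d0 n : 0 < d n by rewrite invr_gt0.
have /choice[u uP] : forall n, exists y, M y /\ rnorm (x - y) ^+ 2 < D + d n ^+ 2.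
  move=> n; have [_ [y My <-] yn] := inf_adherent (exprn_gt0 2 (d0 n)) E_has_inf.
  by exists y.
(* The midpoint of [y] and [z] lies in [M], so its squared distance to [x] is at least [D]. *)
have mid y z : M y -> M z -> 4 * D <= rnorm ((x - y) + (x - z)) ^+ 2.
  move=> My Mz; rewrite (_ : _ + _ = 2%:C *: (x - (2^-1)%:C *: (y + z))); last first.
    rewrite scalerBr scalerA -rmorphM/= divff ?pnatr_eq0// scale1r.
    by rewrite rmorph_nat scaler_nat mulr2n addrACA opprD.
  rewrite rnormZR normr_nat exprMn -natrX ler_pM2l ?ltr0n//.
  by apply: DE; apply: subspaceZ => //; exact: subspaceD.
(* The parallelogram law and [mid] bound the squared distance by [2 * (d n ^+ 2 + d m ^+ 2)], at
   most [4 * d n ^+ 2]. *)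
have uC n m : (n <= m)%N -> rnorm (u m - u n) <= 2 * d n.
  move=> nm; rewrite -(@ler_pXn2r _ 2)// ?nnegrE ?rnorm_ge0 ?mulr_ge0 ?(ltW (d0 _))//.
  have := parallelogram (x - u n) (x - u m).
  rewrite (_ : x - u n - (x - u m) = u m - u n); last by rewrite opprB addrC subrKA.
  have := mid _ _ (uP n).1 (uP m).1.
  have dm : d m <= d n by rewrite lef_pV2 ?posrE ?ltr0n// ler_nat.
  have := uP n; have := uP m; have := d0 n; have := d0 m.
  by move=> dm0 dn0 [_ um] [_ un] mD p; nra.
have [|y [uy yn]] := rnorm_complete (e := fun n => 2 * d n) _ uC.
  move=> e e0; have [n ne] := invS_lt (divr_gt0 e0 (ltr0n _ 2 : 0 < 2)).
  by exists n; rewrite mulrC -ltr_pdivlMr.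
have My : M y.
  by apply: (closed_cvg M clM (nearW _ _) y uy) => n; exact: (uP n).1.
exists y => // m Mm.
have yD : rnorm (x - y) <= Num.sqrt D.
  (* The 3 adds the excess [d n] of [u n] to its distance [2 * d n] from [y]. *)
  rewrite -subr_le0; apply: (@ler_mul_eps _ 3) => e e0; rewrite lerBlDr.
  have [n ne] := invS_lt e0.
  have xun : rnorm (x - u n) <= Num.sqrt D + d n.
    rewrite -(@ler_pXn2r _ 2)// ?nnegrE ?rnorm_ge0 ?addr_ge0 ?sqrtr_ge0 ?(ltW (d0 _))//.
    have := sqrtr_ge0 D; have := sqr_sqrtr D0; have := (uP n).2; have := d0 n.
    by nra.
  have := rnormB (x - u n) (y - u n); rewrite opprB subrKA => H1.
  have := yn n; move: ne; rewrite -/(d n); lra.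
have yDsqr : rnorm (x - y) ^+ 2 <= D.
  by rewrite -(sqr_sqrtr D0) ler_pXn2r// ?nnegrE ?rnorm_ge0// sqrtr_ge0.
set z := x - y in yDsqr *; set h := hdot z m.
(* Moving [y] by [(t%:C * h) *: m] lowers the squared distance by
   [t * r ^+ 2 * (2 - t * rnorm m ^+ 2)], with [r] the modulus of [h]. As [t * rnorm m ^+ 2 <= 1],
   minimality forces [r = 0]; the [+ 1] covers [m = 0]. *)
pose t : R := (rnorm m ^+ 2 + 1)^-1.
have t0 : 0 < t by rewrite invr_gt0 ltr_wpDl// sqr_ge0.
have : D <= rnorm (z - (t%:C * h) *: m) ^+ 2.
  by rewrite /z -addrA -opprD; apply: DE; apply: subspaceD => //; exact: subspaceZ.
set r := complex.Re `|h|.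
have -> : rnorm (z - (t%:C * h) *: m) ^+ 2 =
    rnorm z ^+ 2 + (t * r * rnorm m) ^+ 2 - 2 * (t * r ^+ 2).
  rewrite rnormB_sqr hdotZr rmorphM rnormZ -/h normrM.
  have -> : (t%:C)^*%C * h^*%C * h = (t * r ^+ 2)%:C.
    by rewrite conjc_real -mulrA [h^*%C * h]mulrC -sqr_normc complex_normE -rmorphXn -rmorphM.
  have -> : `|t%:C : R[i]| = t%:C by rewrite ger0_norm// ler0c ltW.
  by rewrite complex_normE -/r -rmorphM.
move=> Dz; have {Dz yDsqr} : r ^+ 2 * (2 - t * rnorm m ^+ 2) <= 0 by nra.
have tm : t * rnorm m ^+ 2 <= 1.
  by rewrite /t mulrC ler_pdivrMr ?mul1r ?lerDl// ltr_wpDl// sqr_ge0.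
move=> r0; apply/normr0_eq0; rewrite complex_normE -/r.
have /eqP : r ^+ 2 = 0 by have := sqr_ge0 r; nra.
by rewrite sqrf_eq0 => /eqP ->.
Qed.

End Projection.

(** * Bounded operators, projections, Riesz representation and adjoints *)

Section Operators.
Context {R : realType} {H : hilbertType R}.
Implicit Types (x y z w : H) (M N : set H) (A B Q : H -> H) (a : R[i]).

Lemma bounded_operator_id : bounded_operator (@idfun H).
Proof. by apply: (@linear_bounded_operator _ _ _ 1) => // x; rewrite mul1r. Qed.

Lemma bounded_operator_comp A B :
  bounded_operator A -> bounded_operator B -> bounded_operator (A \o B).
Proof.
move=> [lA cA] [lB cB]; split=> [a x y /=|x]; first by rewrite lB lA.
by apply: continuous_comp; [exact: cB|exact: cA].
Qed.

Lemma bounded_operatorB A B :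
  bounded_operator A -> bounded_operator B -> bounded_operator (A \- B).
Proof.
move=> [lA cA] [lB cB]; split=> [a x y /=|x].
  by rewrite lB lA scalerBr addrACA opprD.
by apply: cvgB; [exact: cA|exact: cB].
Qed.

Lemma bounded_operatorZ a : bounded_operator (fun x : H => a *: x).
Proof.
apply: (@linear_bounded_operator _ _ _ (complex.Re `|a|)) => [b x y|x].
  by rewrite scalerDr !scalerA mulrC.
by rewrite rnormZ.
Qed.

Lemma subspace_range A : linear A -> subspace (range A).
Proof.
move=> lA; split; first by exists 0 => //; exact: linear_map0.
by move=> a _ _ [x _ <-] [y _ <-]; exists (a *: x + y) => //; exact: lA.
Qed.

Lemma subspace_kernel A : linear A -> subspace (kernel A).
Proof.
move=> lA; split=> [|a x y /= Ax Ay]; first exact: linear_map0.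
by rewrite /kernel/= lA Ax Ay scaler0 addr0.
Qed.

Lemma closed_kernel A : bounded_operator A -> closed (kernel A).
Proof.
move=> bA; have [C C0 AC] := bounded_operator_bound bA.
apply/closed_rnormP => x xA; rewrite /kernel/=.
apply: (@rnorm_le_eps _ _ C) => e /xA[y Ay xye].
rewrite -[A x]subr0 -(Ay : A y = 0) -(linear_mapB bA.1).
by apply: (le_trans (AC _)); rewrite ler_wpM2l// ltW.
Qed.

Lemma subspace_orth_compl M : subspace (orth_compl M).
Proof.
split=> [y _|a x y Mx My z Mz]; first exact: hdot0l.
by rewrite hdotDl hdotZl Mx// My// mulr0 addr0.
Qed.

Lemma complex_le_eps (C : R) a :
  (forall e, 0 < e -> complex.Re `|a| <= C * e) -> a = 0.
Proof.
move=> /ler_mul_eps a0; apply/normr0_eq0; rewrite complex_normE.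
by congr _%:C; apply/eqP; rewrite eq_le a0 -ler0c -complex_normE normr_ge0.
Qed.

Lemma closed_orth_compl M : closed (orth_compl M).
Proof.
apply/closed_rnormP => x xM y My; apply: (@complex_le_eps (rnorm y)) => e /xM[z Mz xze].
rewrite -[hdot x y]subr0 -(Mz y My) -hdotBl mulrC.
by apply: (le_trans (hdot_CauchySchwarz _ _)); rewrite ler_wpM2r ?rnorm_ge0// ltW.
Qed.

Lemma orth_complK M : closed M -> subspace M -> orth_compl (orth_compl M) = M.
Proof.
move=> clM sM; apply/seteqP; split=> [x xM|x Mx y My]; last first.
  exact/hdot_eq0C/My.
have [y My xyM] := projection_exists x clM sM.
suff /subr0_eq -> : x - y = 0 by [].
by apply: hdot_eq0; rewrite hdotBl (xM _ xyM) (hdot_eq0C (xyM _ My)) subrr.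
Qed.

Lemma direct_sum_orth M : closed M -> subspace M -> direct_sum M (orth_compl M).
Proof.
move=> clM sM; split.
  apply/seteqP; split=> [x [Mx xM]|_ ->]; first exact/hdot_eq0/xM.
  by split; [exact: sM.1|exact: (subspace_orth_compl M).1].
move=> x; have [y My xyM] := projection_exists x clM sM.
by exists y, (x - y); split => //; rewrite addrC subrK.
Qed.

Definition is_proj M N Q :=
  [/\ bounded_operator Q, Q \o Q = Q, range Q = M & kernel Q = N].

(** The choice made by [xget] has the required properties once one such projection exists. The
    witness takes the component in [M]; the estimate with [C] makes it continuous. *)
Lemma oblique_projP M N (C : R) : subspace M -> subspace N -> direct_sum M N ->
  (forall y z, M y -> N z -> rnorm y <= C * rnorm (y + z)) ->
  is_proj M N (oblique_proj M N).
Proof.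
move=> sM sN [MN0 MN] MNC; apply: (@xgetPex _ _ (is_proj M N)).
have /choice[Q QP] : forall x, exists y, M y /\ N (x - y).
  by move=> x; have [y [z [My Nz ->]]] := MN x; exists y; rewrite addrC addKr.
have QE x y : M y -> N (x - y) -> Q x = y.
  move=> My Nxy; have [MQ NQ] := QP x; apply/subr0_eq.
  have : (M `&` N) (Q x - y).
    split; first exact: subspaceB.
    rewrite (_ : Q x - y = (x - y) - (x - Q x)); first exact: subspaceB.
    by rewrite opprB [RHS]addrC subrKA.
  by rewrite MN0.
have lQ : linear Q.
  move=> a x y; apply: QE; first by apply: sM.2; [exact: (QP x).1|exact: (QP y).1].
  rewrite opprD addrACA -scalerBr; apply: sN.2; [exact: (QP x).2|exact: (QP y).2].
have QM y : M y -> Q y = y by move=> My; apply: QE; rewrite ?subrr//; exact: sN.1.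
exists Q; split.
- apply: (linear_bounded_operator (C := C)) => // x.
  by have := MNC _ _ (QP x).1 (QP x).2; rewrite addrC subrK.
- by apply/funext => x /=; rewrite QM//; exact: (QP x).1.
- apply/seteqP; split=> [_ [x _ <-]|y My]; first exact: (QP x).1.
  by exists y => //; exact: QM.
- apply/seteqP; split=> [x /= Qx|x Nx /=].
    by have := (QP x).2; rewrite Qx subr0.
  by apply: QE; rewrite ?subr0//; exact: sM.1.
Qed.

Section IsProj.
Variables (M N : set H) (Q : H -> H) (QP : is_proj M N Q).

Lemma is_proj_bounded : bounded_operator Q. Proof. by case: QP. Qed.
Lemma is_proj_range x : M (Q x). Proof. by case: QP => _ _ <- _; exists x. Qed.
Lemma is_proj_id x : M x -> Q x = x.
Proof. by case: QP => _ QQ <- _ [y _ <-]; exact: (congr1 (@^~ y) QQ). Qed.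
Lemma is_proj_eq0 x : N x -> Q x = 0.
Proof. by case: QP => _ _ _ <-. Qed.
Lemma is_proj_kernel x : N (x - Q x).
Proof.
case: QP => bQ QQ _ <-; rewrite /kernel/= (linear_mapB bQ.1).
by rewrite [Q (Q x)](congr1 (@^~ x) QQ) subrr.
Qed.

End IsProj.

Lemma orth_projP M : closed M -> subspace M ->
  is_proj M (orth_compl M) (orth_proj M).
Proof.
move=> clM sM; apply: (@oblique_projP _ _ 1) => //.
- exact: subspace_orth_compl.
- exact: direct_sum_orth.
(* The constant 1 comes from Pythagoras. *)
- move=> y z My zM; rewrite mul1r -(@ler_pXn2r _ 2)// ?nnegrE ?rnorm_ge0//.
  by rewrite rnormD_sqr (hdot_eq0C (zM _ My)) mulr0 addr0 lerDl sqr_ge0.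
Qed.

Lemma orth_proj_sym M x y : closed M -> subspace M ->
  hdot (orth_proj M x) y = hdot x (orth_proj M y).
Proof.
move=> clM sM; have PP := orth_projP clM sM.
transitivity (hdot (orth_proj M x) (orth_proj M y)).
  apply/esym/subr0_eq; rewrite -hdotBr; apply: hdot_eq0C.
  have := subspaceB (subspace_orth_compl M) (subspace_orth_compl M).1 (is_proj_kernel PP y).
  by rewrite sub0r opprB; apply; exact: is_proj_range PP x.
apply/esym/subr0_eq; rewrite -hdotBl.
by apply: (is_proj_kernel PP); exact: is_proj_range PP y.
Qed.

(** For [f] nonzero, take [z] orthogonal to its kernel with [f z] nonzero. The vector
    [f x *: z - f z *: x] lies in the kernel, and pairing it with [z] expresses [f x] through
    [hdot x z]. *)
Lemma riesz (f : H -> R[i]) (C : R) :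
  (forall a x y, f (a *: x + y) = a * f x + f y) ->
  (forall x, complex.Re `|f x| <= C * rnorm x) ->
  exists w, forall x, f x = hdot x w.
Proof.
move=> lf fC; have f0 : f 0 = 0.
  by apply/(addIr (f 0)); rewrite -{1}[f 0]mul1r -lf scale1r !add0r.
have fZ a x : f (a *: x) = a * f x by rewrite -[a *: x]addr0 lf f0 addr0.
have fB x y : f (x - y) = f x - f y by rewrite addrC -scaleN1r lf mulN1r addrC.
pose M := f @^-1` [set 0].
have clM : closed M.
  apply/closed_rnormP => x xM; apply: (@complex_le_eps `|C|) => e /xM[y My xye].
  rewrite -[f x]subr0 -My -fB; apply: (le_trans (fC _)).
  apply: (le_trans (ler_wpM2r (rnorm_ge0 _) (ler_norm C))).
  by rewrite ler_wpM2l// ltW.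
have sM : subspace M by split=> // a x y; rewrite /M/= lf => -> ->; rewrite mulr0 addr0.
have [fx0|/existsNP[x0 fx0]] := pselect (forall x, f x = 0).
  by exists 0 => x; rewrite hdot0r fx0.
have [y My] := projection_exists x0 clM sM; set z := x0 - y => zM.
have fz : f z != 0 by rewrite fB My subr0; exact/eqP.
have zz : hdot z z != 0.
  by apply: contraNN fz => /eqP/hdot_eq0 ->; rewrite f0.
(* The conjugate cancels the conjugate-linearity of the second argument. *)
exists ((f z / hdot z z)^*%C *: z) => x; rewrite hdotZr conjcK.
have : M (f x *: z - f z *: x) by rewrite /M/= fB !fZ mulrC subrr.
move=> /zM/hdot_eq0C; rewrite hdotBl !hdotZl => /subr0_eq fxz.
by rewrite mulrAC -fxz mulfK.
Qed.

(** Riesz representation of [hdot (A x) y] in [x] gives the adjoint [B]; [rnorm (B y) ^+ 2], which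
    is [hdot (A (B y)) y], shows that a bound for [A] also bounds [B]. *)
Lemma adjointP A : bounded_operator A -> bounded_operator (adjoint A) /\
  forall x y, hdot (A x) y = hdot x (adjoint A y).
Proof.
move=> bA; apply: (@xgetPex _ _ [set B | bounded_operator B /\
  forall x y, hdot (A x) y = hdot x (B y)]).
have [C C0 AC] := bounded_operator_bound bA.
have /choice[B BP] : forall y, exists w, forall x, hdot (A x) y = hdot x w.
  move=> y; apply: (@riesz _ (C * rnorm y)) => [a x x'|x].
    by rewrite bA.1 hdotDl hdotZl.
  apply: (le_trans (hdot_CauchySchwarz _ _)).
  by rewrite mulrAC ler_wpM2r ?rnorm_ge0.
have {}BP y x : hdot (A x) y = hdot x (B y) by [].
have hdotI v w : (forall x, hdot x v = hdot x w) -> v = w.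
  by move=> vw; apply/subr0_eq/hdot_eq0; rewrite hdotBr vw subrr.
exists B; split=> //; apply: (linear_bounded_operator (C := C)).
  by move=> a y z; apply: hdotI => x; rewrite -BP !hdotDr !hdotZr !BP.
move=> y; have [->|By0] := eqVneq (B y) 0; first by rewrite rnorm0 mulr_ge0 ?rnorm_ge0.
have By_gt0 : 0 < rnorm (B y).
  rewrite lt_neqAle rnorm_ge0 andbT eq_sym.
  by apply: contraNN By0 => /eqP/rnorm0_eq0 ->.
rewrite -(ler_pM2l By_gt0); have := hdot_CauchySchwarz (A (B y)) y.
rewrite BP hdotxx ger0_norm ?ler0c ?sqr_ge0//= -expr2 => /le_trans; apply.
by rewrite mulrA ler_wpM2r ?rnorm_ge0// [leRHS]mulrC.
Qed.

Lemma adjoint_uniq A B : bounded_operator A ->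
  (forall x y, hdot (A x) y = hdot x (B y)) -> adjoint A = B.
Proof.
move=> /adjointP[_ AP] BP; apply/funext => y; apply/subr0_eq/hdot_eq0.
by rewrite hdotBr -AP BP subrr.
Qed.

Lemma hermitian_operatorP A : bounded_operator A ->
  hermitian_operator A <-> forall x y, hdot (A x) y = hdot x (A y).
Proof.
move=> bA; split=> [hA x y|]; last exact: adjoint_uniq.
by rewrite (adjointP bA).2 hA.
Qed.

Lemma adjointK A : bounded_operator A -> adjoint (adjoint A) = A.
Proof.
move=> /adjointP[bA AP]; apply: adjoint_uniq => // x y.
by rewrite hdotC -AP -hdotC.
Qed.

Lemma kernel_adjoint A : bounded_operator A -> kernel (adjoint A) = orth_compl (range A).
Proof.
move=> /adjointP[_ AP]; apply/seteqP; split=> [y Ay _ [x _ <-]|y yA].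
  by apply: hdot_eq0C; rewrite AP Ay hdot0r.
by apply: hdot_eq0; rewrite -AP; apply: hdot_eq0C; apply: yA; exists (adjoint A y).
Qed.

End Operators.

(** * Uniform boundedness and closed range estimates *)

Section ClosedRange.
Context {R : realType} {H : hilbertType R}.
Implicit Types (x y z w : H) (M N : set H) (A B Q : H -> H) (a : R[i]).

(* Uniform boundedness on a Hilbert space by the gliding hump argument: moving
   by 3^-n along the n-th vector w_n, with the sign that does not decrease the
   modulus of its product with w_n, costs later only half of the gain. *)
Lemma weakly_bounded (F : set H) :
  (forall y, exists C : R, forall w, F w -> complex.Re `|hdot y w| <= C) ->
  exists C : R, forall w, F w -> rnorm w <= C.
Proof.
move=> Fwb; apply: contrapT => /forallNP Fub.
(* Multiplied by the step [3 ^- n], this norm exceeds [2 * n%:R], so that [n%:R] remains after half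
   of the gain is lost. *)
have /choice[w wP] : forall n, exists w, F w /\ 2 * n%:R * 3 ^+ n < rnorm w.
  move=> n; have /existsNP[w /not_implyP[Fw /negP]] := Fub (2 * n%:R * 3 ^+ n).
  by rewrite -ltNge; exists w.
pose e n : R := 3 ^- n.
have e0 n : 0 < e n by rewrite invr_gt0 exprn_gt0.
have eS n : e n = 3 * e n.+1 by rewrite /e exprS invfM mulrA mulfV ?mul1r.
have w0 n : 0 < rnorm (w n).
  by apply: le_lt_trans (wP n).2; rewrite !mulr_ge0 ?exprn_ge0.
have /choice[g gP] : forall p : nat * H, exists v,
    rnorm (v - p.2) = e p.1 /\ e p.1 * rnorm (w p.1) <= complex.Re `|hdot v (w p.1)|.
  move=> [n v] /=; pose s := e n / rnorm (w n).
  have s0 : 0 <= s by rewrite divr_ge0 ?(ltW (e0 n)) ?(ltW (w0 n)).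
  have sw : s * rnorm (w n) = e n by rewrite divfK ?gt_eqF.
  have hs : hdot (s%:C *: w n) (w n) = (e n * rnorm (w n))%:C.
    by rewrite hdotZl hdotxx -rmorphM/= expr2 mulrA sw.
  have ns : rnorm (s%:C *: w n) = e n by rewrite rnormZR ger0_norm.
  set b := _ * rnorm (w n); set h := hdot v (w n).
  have b0 : 0 < b by rewrite mulr_gt0.
  (* The two numbers differ by [2 * b], so one has modulus at least [b]. *)
  have : b <= complex.Re `|h + b%:C| \/ b <= complex.Re `|h - b%:C|.
    have := Re_normD (h + b%:C) (- (h - b%:C)).
    rewrite normrN (_ : _ - (h - b%:C) = (b + b)%:C); last by rewrite rmorphD/=; ring.
    rewrite Re_norm_real (gtr0_norm (addr_gt0 b0 b0)).
    by case: (lerP b (complex.Re `|h + b%:C|)) => [|h1 h2]; [left|right; lra].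
  case=> hb.
    by exists (v + s%:C *: w n); rewrite addrC addKr hdotDl hs.
  by exists (v - s%:C *: w n); rewrite addrC addKr rnormN hdotBl hs.
pose fix u n := if n is m.+1 then g (m, u m) else 0.
have uS n : rnorm (u n.+1 - u n) = e n := (gP (n, u n)).1.
have uw n : e n * rnorm (w n) <= complex.Re `|hdot (u n.+1) (w n)| := (gP (n, u n)).2.
(* [3 / 2 * e n] is the sum of all steps from [n] on; at [n.+1] it equals [e n / 2]. *)
have uC n m : (n <= m)%N -> rnorm (u m - u n) <= 3 / 2 * e n.
  move=> /subnKC <-; move: (m - n)%N => k {m}.
  suff : rnorm (u (n + k)%N - u n) <= 3 / 2 * e n - 3 / 2 * e (n + k)%N.
    by have := e0 (n + k)%N; lra.
  elim: k => [|k IH]; first by rewrite addn0 !subrr rnorm0.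
  rewrite addnS -[u (n + k).+1](subrK (u (n + k)%N)) -addrA.
  apply: (le_trans (rnormD _ _)); rewrite uS.
  by have := eS (n + k)%N; nra.
have [|l [_ ul]] := rnorm_complete (e := fun n => 3 / 2 * e n) _ uC.
  move=> d d0; have [n] := invS_lt (divr_gt0 d0 (ltr0n _ 2 : 0 < 2)).
  rewrite ltr_pdivlMr// => nd; exists n.
  suff : e n <= n.+1%:R^-1 by move: nd; move: (_^-1) (e n) (e0 n) => r s s0 rd sr; nra.
  rewrite lef_pV2 ?posrE ?exprn_gt0// -natrX ler_nat.
  exact: ltn_expl.
have [C lC] := Fwb l.
have := lC _ (wP (Num.truncn C).+1).1; apply/negP; rewrite -ltNge.
set n := (Num.truncn C).+1.
have Cn : C < n%:R by rewrite truncnS_gt.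
apply: (lt_le_trans Cn).
have := Re_normD (hdot l (w n)) (- (hdot (l - u n.+1) (w n))).
rewrite normrN hdotBl opprB addrCA subrr addr0.
have := hdot_CauchySchwarz (l - u n.+1) (w n); rewrite -hdotBl => h1 h2.
have h3 := uw n.
have h4 : rnorm (l - u n.+1) * rnorm (w n) <= e n / 2 * rnorm (w n).
  by rewrite ler_wpM2r ?rnorm_ge0//; have := ul n.+1; have := eS n; lra.
have : 2 * n%:R <= e n * rnorm (w n).
  by rewrite [leRHS]mulrC ler_pdivlMr ?exprn_gt0// ltW// (wP n).2.
lra.
Qed.

(** Since the projection of [y] to the range is some [A x], pairing [y] with the projection of [w]
    gives [hdot x (adjoint A w)], bounded by [rnorm x] when [rnorm (adjoint A w) <= 1]. Uniform
    boundedness applies to these projections. *)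
Lemma closed_range_adjoint_bound A : bounded_operator A -> closed (range A) ->
  exists2 K : R, 0 < K & forall w, range A w -> rnorm w <= K * rnorm (adjoint A w).
Proof.
move=> bA clA; have [bA' AP] := adjointP bA.
have sA := subspace_range bA.1.
pose F := [set orth_proj (range A) w | w in [set w | rnorm (adjoint A w) <= 1]].
have [y|C FC] := @weakly_bounded F.
  have [x _ Ax] := is_proj_range (orth_projP clA sA) y.
  exists (rnorm x) => _ [w /= w1 <-]; rewrite -orth_proj_sym// -Ax AP.
  by apply: (le_trans (hdot_CauchySchwarz _ _)); rewrite ler_piMr ?rnorm_ge0.
exists (`|C| + 1); first by rewrite ltr_wpDl.
move=> w Aw; rewrite leNgt; apply/negP; set K := `|C| + 1 => Kw.
have K0 : 0 < K by rewrite ltr_wpDl.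
have r0 := rnorm_ge0 (adjoint A w).
have w0 : 0 < rnorm w by apply: le_lt_trans Kw; rewrite mulr_ge0// ltW.
(* This scaling gives [v] the norm [K], above the uniform bound [C], while [adjoint A v] stays in
   the unit ball. *)
pose v := (K / rnorm w)%:C *: w.
have vF : F v.
  exists v; last by apply: (is_proj_id (orth_projP clA sA)); exact: subspaceZ.
  rewrite /= (linear_mapZ bA'.1) rnormZR ger0_norm ?divr_ge0 ?(ltW K0) ?(ltW w0)//.
  by rewrite mulrAC ler_pdivrMr// mul1r ltW.
have := FC _ vF; rewrite rnormZR ger0_norm ?divr_ge0 ?(ltW K0) ?(ltW w0)//.
by rewrite divfK ?gt_eqF// /K; have := ler_norm C; lra.
Qed.

(** The lower bound on [M] turns approximations of [y] by images into a Cauchy sequence of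
    preimages. *)
Lemma closed_image A M (K : R) : bounded_operator A -> closed M -> subspace M ->
  0 <= K -> (forall x, M x -> rnorm x <= K * rnorm (A x)) -> closed (A @` M).
Proof.
move=> bA clM sM K0 MK; apply/closed_rnormP => y yA.
pose d n : R := n.+1%:R^-1.
have d0 n : 0 < d n by rewrite invr_gt0.
have /choice[u uP] : forall n, exists x, M x /\ rnorm (y - A x) < d n.
  by move=> n; have [_ [x Mx <-] xn] := yA _ (d0 n); exists x.
have uC n m : (n <= m)%N -> rnorm (u m - u n) <= K * (2 * d n).
  move=> nm; have dm : d m <= d n by rewrite lef_pV2 ?posrE ?ltr0n// ler_nat.
  apply: le_trans (MK _ (subspaceB sM (uP m).1 (uP n).1)) _.
  rewrite ler_wpM2l// (linear_mapB bA.1) -(subrKA y).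
  apply: (le_trans (rnormD _ _)); rewrite rnorm_distC.
  by have := (uP m).2; have := (uP n).2; lra.
have [|x [ux xn]] := rnorm_complete (e := fun n => K * (2 * d n)) _ uC.
  move=> e e0; have K1 : 0 < 2 * K + 1 by lra.
  have [n] := invS_lt (divr_gt0 e0 K1); rewrite ltr_pdivlMr// -/(d n) => ne.
  by exists n; have := d0 n; lra.
exists x; first by apply: (cvg_closed clM _ ux) => n; exact: (uP n).1.
have [C C0 AC] := bounded_operator_bound bA.
apply/esym/subr0_eq/(@rnorm_le_eps _ _ (1 + C * (K * 2))) => e e0.
have [n ne] := invS_lt e0.
rewrite -(subrKA (A (u n))) -(linear_mapB bA.1).
apply: (le_trans (rnormD _ _)); rewrite mulrDl mul1r lerD//.
  by apply/ltW/(lt_trans (uP n).2).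
apply: (le_trans (AC _)); rewrite -mulrA ler_wpM2l// rnorm_distC -mulrA.
by apply: (le_trans (xn n)); rewrite ler_wpM2l// ler_pM2l// ltW.
Qed.

(** [adjoint A] vanishes on the orthogonal complement of [range A], so its range is the image of
    [range A], where it is bounded below. *)
Lemma closed_range_adjoint A : bounded_operator A -> closed (range A) ->
  closed (range (adjoint A)).
Proof.
move=> bA clA; have [K K0 AK] := closed_range_adjoint_bound bA clA.
have [bA' AP] := adjointP bA; have sA := subspace_range bA.1.
rewrite (_ : range (adjoint A) = adjoint A @` range A).
  exact: (closed_image bA' clA sA (ltW K0)).
apply/seteqP; split=> _ [x _ <-]; last by exists x.
have [y Ay xyA] := projection_exists x clA sA; exists y => //.
apply/esym/subr0_eq; rewrite -(linear_mapB bA'.1).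
by move: xyA; rewrite -kernel_adjoint.
Qed.

Lemma orth_proj_adjointP A : bounded_operator A -> closed (range A) ->
  is_proj (range (adjoint A)) (kernel A) (orth_proj (range (adjoint A))).
Proof.
move=> bA clA; have bA' := (adjointP bA).1.
rewrite -[in kernel A](adjointK bA) kernel_adjoint//.
by apply: orth_projP; [exact: closed_range_adjoint|exact: subspace_range bA'.1].
Qed.

(** The estimate for adjoints, applied to [adjoint A]; projecting [x] removes only a kernel
    component and leaves [A x] unchanged. *)
Lemma closed_range_bound A : bounded_operator A -> closed (range A) ->
  exists2 K : R, 0 < K &
    forall x, rnorm (orth_proj (range (adjoint A)) x) <= K * rnorm (A x).
Proof.
move=> bA clA; have bA' := (adjointP bA).1.
have [K K0] := closed_range_adjoint_bound bA' (closed_range_adjoint bA clA).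
rewrite adjointK// => AK; exists K => // x; have PP := orth_proj_adjointP bA clA.
apply: (le_trans (AK _ (is_proj_range PP x))).
rewrite (_ : A x = A (orth_proj (range (adjoint A)) x))//.
by apply/subr0_eq; rewrite -(linear_mapB bA.1); exact: is_proj_kernel PP x.
Qed.

(** The lower bound gives injectivity and a closed range; injectivity of the adjoint leaves no
    vector orthogonal to that range. *)
Lemma bounded_below_invertible A (K : R) : bounded_operator A ->
  (forall x, rnorm x <= K * rnorm (A x)) ->
  (forall y, adjoint A y = 0 -> y = 0) ->
  exists B, [/\ bounded_operator B, B \o A = idfun & A \o B = idfun].
Proof.
move=> bA AK A'0.
have K0 x : rnorm x <= `|K| * rnorm (A x).
  by apply: (le_trans (AK x)); rewrite ler_wpM2r ?rnorm_ge0// ler_norm.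
have surj y : exists x, A x = y.
  have sM : subspace [set: H] by split.
  have cl : closed (range A) by apply: (closed_image bA closedT sM (normr_ge0 K)) => x _.
  have [_ [x _ <-]] := projection_exists y cl (subspace_range bA.1).
  by rewrite -kernel_adjoint// => /A'0/subr0_eq ->; exists x.
have inj x y : A x = A y -> x = y.
  move=> Axy; apply/subr0_eq/rnorm0_eq0/eqP; rewrite eq_le rnorm_ge0 andbT.
  by apply: (le_trans (K0 _)); rewrite (linear_mapB bA.1) Axy subrr rnorm0 mulr0.
have /choice[B AB] := surj.
exists B; split; [|by apply/funext => x /=; exact: inj|exact/funext].
apply: (linear_bounded_operator (C := `|K|)) => [a x y|x].
  by apply: inj; rewrite bA.1 !AB.
by rewrite -[in leRHS](AB x).
Qed.

End ClosedRange.

(** * Operator norm and spectral radius *)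

Section Spectrum.
Context {R : realType} {H : hilbertType R}.
Implicit Types (x y z w : H) (A B : H -> H) (l : R[i]).

Lemma opnorm_has_sup A : bounded_operator A ->
  has_sup [set complex.Re `|A x| | x in [set x : H | `|x| <= 1]].
Proof.
move=> bA; have [C C0 AC] := bounded_operator_bound bA.
split; first by exists (complex.Re `|A 0|), 0 => //=; rewrite normr0 ler01.
exists C => _ [x /= x1 <-]; apply: (le_trans (AC x)).
by rewrite ler_piMr// -lecR -rnormE.
Qed.

Lemma opnorm_ge A x : bounded_operator A -> rnorm x <= 1 -> rnorm (A x) <= opnorm A.
Proof.
move=> bA x1; apply: ub_le_sup; first exact: (opnorm_has_sup bA).2.
by exists x => //=; rewrite rnormE lecR.
Qed.

Lemma opnorm_ge0 A : bounded_operator A -> 0 <= opnorm A.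
Proof.
by move=> bA; apply: le_trans (opnorm_ge bA (_ : rnorm 0 <= 1)); rewrite ?rnorm_ge0// rnorm0.
Qed.

Lemma opnorm_le A (C : R) : bounded_operator A ->
  (forall x, rnorm x <= 1 -> rnorm (A x) <= C) -> opnorm A <= C.
Proof.
move=> bA AC; apply: ge_sup; first exact: (opnorm_has_sup bA).1.
by move=> _ [x /= x1 <-]; apply: AC; rewrite -lecR -rnormE.
Qed.

Lemma opnormP A x : bounded_operator A -> rnorm (A x) <= opnorm A * rnorm x.
Proof.
move=> bA; have [->|x0] := eqVneq x 0.
  by rewrite (linear_map0 bA.1) rnorm0 mulr0.
have x_gt0 : 0 < rnorm x.
  rewrite lt_neqAle rnorm_ge0 andbT eq_sym.
  by apply: contraNN x0 => /eqP/rnorm0_eq0 ->.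
have := @opnorm_ge A ((rnorm x)^-1%:C *: x) bA.
rewrite (linear_mapZ bA.1) !rnormZR gtr0_norm ?invr_gt0// mulVf ?gt_eqF//.
by move=> /(_ (lexx _)); rewrite mulrC ler_pdivrMr.
Qed.

(** If [l] exceeds the norm in modulus, [A - l] is bounded below by the difference. If its adjoint
    kills [y], then [hdot (A y) y = l * hdot y y], and Cauchy-Schwarz gives [y = 0]. *)
Lemma spectrum_le_opnorm A l : bounded_operator A -> spectrum A l ->
  complex.Re `|l| <= opnorm A.
Proof.
move=> bA lA; rewrite leNgt; apply/negP => Al; apply: lA.
pose S x := A x - l *: x; pose d := complex.Re `|l| - opnorm A.
have d0 : 0 < d by rewrite subr_gt0.
have bS : bounded_operator S by exact: bounded_operatorB bA (bounded_operatorZ l).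
apply: (@bounded_below_invertible _ _ S d^-1) => //.
  move=> x; rewrite mulrC ler_pdivlMr// mulrC mulrBl -rnormZ.
  rewrite lerBlDr -[l *: x](subrK (A x)) addrC.
  apply: (le_trans (rnormD _ _)); rewrite addrC rnorm_distC lerD//.
  exact: opnormP.
move=> y Sy; apply: rnorm0_eq0; apply/eqP; rewrite -sqrf_eq0 eq_le sqr_ge0 andbT.
rewrite -(pmulr_rle0 _ d0) mulrBl subr_le0.
have : hdot (A y) y = l * hdot y y.
  apply/subr0_eq; rewrite -hdotZl -hdotBl -/(S y).
  by rewrite (adjointP bS).2 Sy hdot0r.
rewrite hdotxx => /(congr1 (fun a => complex.Re `|a|)).
rewrite normrM [X in _ * X]ger0_norm ?ler0c ?sqr_ge0// complex_normE -rmorphM/= => <-.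
apply: (le_trans (hdot_CauchySchwarz _ _)).
by rewrite expr2 mulrA ler_wpM2r ?rnorm_ge0// opnormP.
Qed.

Lemma spectral_radius_le_opnorm A : bounded_operator A ->
  spectral_radius A <= opnorm A.
Proof.
move=> bA; have [[l Al]|A0] := pselect (spectrum A !=set0).
  apply: ge_sup; first by exists (complex.Re `|l|), l.
  by move=> _ [m Am <-]; exact: spectrum_le_opnorm.
(* For an empty spectrum the supremum takes its default value 0. *)
rewrite /spectral_radius (_ : [set _ | _ in _] = set0) ?sup0 ?opnorm_ge0//.
by rewrite -subset0 => r [l Al _]; apply: A0; exists l.
Qed.

Lemma spectrum_le_spectral_radius A l : bounded_operator A -> spectrum A l ->
  complex.Re `|l| <= spectral_radius A.
Proof.
move=> bA Al; apply: ub_le_sup; last by exists l.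
by exists (opnorm A) => _ [m Am <-]; exact: spectrum_le_opnorm.
Qed.

(* If both b and -b (b = ||A||) were regular values, then A^2 - b^2 would be
   bounded below; but |A^2 x - b^2 x|^2 <= b^2 (b^2 - |A x|^2) on the unit ball,
   and |A x| comes arbitrarily close to b there. *)
Lemma hermitian_opnorm_spectrum A : bounded_operator A -> hermitian_operator A ->
  0 < opnorm A ->
  spectrum A (opnorm A)%:C \/ spectrum A (- opnorm A)%:C.
Proof.
move=> bA /(hermitian_operatorP bA) hA; set b := opnorm A => b0.
apply: contrapT => /not_orP[/contrapT[B [bB BA _]] /contrapT[C [bC CA _]]].
have [K K0 BK] := bounded_operator_bound (bounded_operator_comp bB bC).
have AbA x : rnorm x <= K * rnorm (A (A x) - (b ^+ 2)%:C *: x).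
  have BAx y : B (A y - b%:C *: y) = y := congr1 (@^~ y) BA.
  have CAx y : C (A y - (- b)%:C *: y) = y := congr1 (@^~ y) CA.
  (* Factor [A^2 - b^2] as [(A + b) (A - b)] and undo each factor by its left inverse. *)
  rewrite -[in leLHS](BAx x) -[in leLHS](CAx (A x - b%:C *: x)).
  apply: (le_trans (BK _)); rewrite (_ : A _ - _ = A (A x) - (b ^+ 2)%:C *: x)//.
  rewrite (linear_mapB bA.1) (linear_mapZ bA.1) rmorphN scaleNr opprK scalerBr.
  by rewrite addrA subrK scalerA -rmorphM -expr2.
have AbA_le x : rnorm x <= 1 ->
    rnorm (A (A x) - (b ^+ 2)%:C *: x) ^+ 2 <= b ^+ 2 * (b ^+ 2 - rnorm (A x) ^+ 2).
  move=> x1; rewrite rnormB_sqr hdotZr conjc_real hA hdotxx -rmorphM/=.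
  rewrite rnormZR ger0_norm ?sqr_ge0//.
  have h1 : rnorm (A (A x)) ^+ 2 <= b ^+ 2 * rnorm (A x) ^+ 2.
    rewrite -exprMn ler_pXn2r ?nnegrE ?rnorm_ge0 ?mulr_ge0 ?rnorm_ge0 ?(ltW b0)//.
    exact: opnormP.
  have h2 : rnorm x ^+ 2 <= 1 by rewrite exprn_ile1 ?rnorm_ge0.
  have h3 : (b ^+ 2 * rnorm x) ^+ 2 <= b ^+ 2 * b ^+ 2.
    by rewrite exprMn -expr2 ler_piMr// sqr_ge0.
  lra.
(* Chaining [AbA] and [AbA_le] with [rnorm (A x) <= b * rnorm x] and solving for [rnorm (A x) ^+ 2]
   gives at most [b ^+ 2 * q] on the unit ball; [q < 1] contradicts the choice of [b]. *)
pose q := K ^+ 2 * b ^+ 4 / (1 + K ^+ 2 * b ^+ 4).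
have Kb0 : 0 <= K ^+ 2 * b ^+ 4 by rewrite mulr_ge0 ?exprn_ge0 ?(ltW b0).
have q1 : q < 1 by rewrite ltr_pdivrMr ?mul1r ?ltrDr ?ltr_pwDl.
have q0 : 0 <= q by rewrite divr_ge0 ?addr_ge0.
suff : b <= b * Num.sqrt q.
  rewrite ler_pMr//; apply/negP; rewrite -ltNge.
  by rewrite -sqrtr1 ltr_sqrt.
apply: opnorm_le => // x x1.
rewrite -(@ler_pXn2r _ 2)// ?nnegrE ?rnorm_ge0 ?mulr_ge0 ?sqrtr_ge0 ?(ltW b0)//.
rewrite exprMn sqr_sqrtr// mulrA ler_pdivlMr ?ltr_pwDl//.
have h1 : rnorm (A x) ^+ 2 <= b ^+ 2 * rnorm x ^+ 2.
  rewrite -exprMn ler_pXn2r ?nnegrE ?rnorm_ge0 ?mulr_ge0 ?rnorm_ge0 ?(ltW b0)//.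
  exact: opnormP.
have h2 : rnorm x ^+ 2 <= K ^+ 2 * rnorm (A (A x) - (b ^+ 2)%:C *: x) ^+ 2.
  by rewrite -exprMn ler_pXn2r ?nnegrE ?rnorm_ge0 ?mulr_ge0 ?rnorm_ge0.
have h3 := AbA_le x x1.
have h4 : b ^+ 2 * rnorm x ^+ 2 <=
    b ^+ 2 * (K ^+ 2 * (b ^+ 2 * (b ^+ 2 - rnorm (A x) ^+ 2))).
  rewrite ler_wpM2l ?sqr_ge0//; apply: (le_trans h2).
  by rewrite ler_wpM2l ?sqr_ge0.
rewrite (_ : _ * (K ^+ 2 * b ^+ 4) = rnorm (A x) ^+ 2 * (K ^+ 2 * b ^+ 4) +
    b ^+ 2 * (K ^+ 2 * (b ^+ 2 * (b ^+ 2 - rnorm (A x) ^+ 2)))); last by ring.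
by rewrite mulrDr mulr1 addrC lerD2l; apply: le_trans h4.
Qed.

(** A positive norm is the modulus of a spectral value; for norm 0 the bound is [0 < t]. *)
Lemma hermitian_opnorm_lt A (t : R) : bounded_operator A -> hermitian_operator A ->
  0 < t -> spectral_radius A < t -> opnorm A < t.
Proof.
move=> bA hA t0 At; have [b0|b0] := ltP 0 (opnorm A); last exact: le_lt_trans b0 t0.
by have [|] := hermitian_opnorm_spectrum bA hA b0 => /(spectrum_le_spectral_radius bA);
  rewrite Re_norm_real ?normrN gtr0_norm// => /le_lt_trans; apply.
Qed.

End Spectrum.

(** * Split operators and the Penrose inverse of their projection *)

Section SplitOperators.
Context {R : realType} {H : hilbertType R}.
Implicit Types (x y z w : H) (T Q X : H -> H).

(* T and T^2 have the same range and kernel, so the closed range estimate for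
   T^2 bounds T below on its range. *)
Lemma split_bounded_below T : split_operator T ->
  exists2 K : R, 0 < K & forall y, range T y -> rnorm y <= K * rnorm (T y).
Proof.
move=> [bT clT [RN0 RN]]; have sR := subspace_range bT.1.
have bT2 := bounded_operator_comp bT bT.
have rT2 : range (T \o T) = range T.
  apply/seteqP; split=> [_ [x _ <-]|_ [x _ <-]]; first by exists (T x).
  have [_ [z [[y _ <-] Tz ->]]] := RN x; exists y => //=.
  by rewrite (linear_mapD bT.1) (Tz : T z = 0) addr0.
have kT2 x : T (T x) = 0 -> T x = 0.
  move=> TTx; have : (range T `&` kernel T) (T x) by split => //; exists x.
  by rewrite RN0.
have clT2 : closed (range (T \o T)) by rewrite rT2.
have [K K0 TK] := closed_range_bound bT2 clT2.
have PP := orth_proj_adjointP bT2 clT2.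
have [C C0 TC] := bounded_operator_bound bT.
exists ((C + 1) * K) => [|_ [x _ <-]]; first by rewrite mulr_gt0// ltr_wpDl.
set P := orth_proj _ in TK PP.
(* [P] projects along the kernel of [T \o T], which [kT2] places inside that of [T]. *)
have -> : T x = T (P x).
  by apply/subr0_eq; rewrite -(linear_mapB bT.1); apply: kT2; exact: is_proj_kernel PP x.
apply: (le_trans (TC _)); rewrite (le_trans (_ : _ <= (C + 1) * rnorm (P x)))//.
  by rewrite ler_wpM2r ?rnorm_ge0// lerDl.
rewrite -mulrA ler_wpM2l ?addr_ge0//; have := TK x.
rewrite /= (_ : T (T x) = T (T (P x)))//.
by apply/subr0_eq; rewrite -!(linear_mapB bT.1); exact: is_proj_kernel PP x.
Qed.

(** For [y] in the range and [z] in the kernel, [T y = T (y + z)]; the lower bound [K] on the range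
    and the bound [C] of [T] give the constant [K * C]. *)
Lemma split_projP T : split_operator T ->
  is_proj (range T) (kernel T) (split_proj T).
Proof.
move=> sT; have [bT clT RN] := sT; have [K K0 TK] := split_bounded_below sT.
have [C C0 TC] := bounded_operator_bound bT.
apply: (@oblique_projP _ _ _ _ (K * C)) => //.
- exact: subspace_range bT.1.
- exact: subspace_kernel bT.1.
- move=> y z Ry Tz; apply: (le_trans (TK _ Ry)); rewrite -mulrA ler_wpM2l ?(ltW K0)//.
  by have := TC (y + z); rewrite (linear_mapD bT.1) (Tz : T z = 0) addr0.
Qed.

(** A Penrose inverse of [Q] is [F \o E], with [E] and [F] the orthogonal projections onto [M] and
    onto the orthogonal complement of [N]: its products with [Q] are [E] and [F]. *)
Lemma MPinverse_projP M N Q : closed M -> is_proj M N Q ->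
  let X := MPinverse Q in
  bounded_operator X /\
  [/\ Q \o X \o Q = Q, X \o Q \o X = X,
      hermitian_operator (Q \o X) & hermitian_operator (X \o Q)].
Proof.
move=> clM QP; apply: (@xgetPex _ _ [set X | bounded_operator X /\
  [/\ Q \o X \o Q = Q, X \o Q \o X = X,
      hermitian_operator (Q \o X) & hermitian_operator (X \o Q)]]).
have bQ := is_proj_bounded QP.
have [sM sN] : subspace M /\ subspace N.
  by case: QP => _ _ <- <-; split; [exact: subspace_range bQ.1|exact: subspace_kernel bQ.1].
have clN : closed N by case: QP => _ _ _ <-; exact: closed_kernel.
have clN' : closed (orth_compl N) by exact: closed_orth_compl.
have sN' := subspace_orth_compl N.
have PM := orth_projP clM sM; have PN := orth_projP clN' sN'.
rewrite orth_complK// in PN.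
set E := orth_proj M in PM *; set F := orth_proj (orth_compl N) in PN *.
have bE := is_proj_bounded PM; have bF := is_proj_bounded PN.
have QF x : Q (F x) = Q x.
  apply/esym/subr0_eq; rewrite -(linear_mapB bQ.1).
  exact: is_proj_eq0 QP _ (is_proj_kernel PN x).
have FQ x : F (Q x) = F x.
  apply/esym/subr0_eq; rewrite -(linear_mapB bF.1).
  exact: is_proj_eq0 PN _ (is_proj_kernel QP x).
have EQ x : E (Q x) = Q x by apply: (is_proj_id PM); exact: is_proj_range QP x.
have QE x : Q (E x) = E x by apply: (is_proj_id QP); exact: is_proj_range PM x.
exists (F \o E); split; first exact: bounded_operator_comp.
have QX : Q \o (F \o E) = E by apply/funext => x /=; rewrite QF QE.
have XQ : (F \o E) \o Q = F by apply/funext => x /=; rewrite EQ FQ.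
rewrite QX XQ; split.
- by apply/funext => x /=; rewrite EQ.
- by apply/funext => x /=; rewrite [F (F _)](is_proj_id PN)//; exact: is_proj_range PN _.
- by apply/(hermitian_operatorP bE) => x y; exact: orth_proj_sym.
- by apply/(hermitian_operatorP bF) => x y; exact: orth_proj_sym.
Qed.

(** The difference of the two projections at [x] lies both in the kernel of [Q] and in its
    orthogonal complement. *)
Lemma hermitian_idempotentE Q : bounded_operator Q -> hermitian_operator Q ->
  Q \o Q = Q -> Q = orth_proj (orth_compl (kernel Q)).
Proof.
move=> bQ /(hermitian_operatorP bQ) hQ QQ; apply/funext => x.
have clN := closed_kernel bQ; have sN := subspace_kernel bQ.1.
have sN' := subspace_orth_compl (kernel Q).
have PP := orth_projP (@closed_orth_compl _ _ (kernel Q)) sN'.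
rewrite orth_complK// in PP.
set P := orth_proj _ in PP *.
have NQx z : kernel Q (z - Q z).
  by rewrite /kernel/= (linear_mapB bQ.1) [Q (Q z)](congr1 (@^~ z) QQ) subrr.
apply/subr0_eq/hdot_eq0.
have N'x : orth_compl (kernel Q) (Q x - P x).
  apply: (subspaceB sN'); last exact: is_proj_range PP x.
  by move=> y Qy; rewrite hQ (Qy : Q y = 0) hdot0r.
apply: N'x; rewrite (_ : Q x - P x = (x - P x) - (x - Q x)).
  by apply: (subspaceB sN) => //; exact: is_proj_kernel PP x.
by rewrite opprB [RHS]addrC subrKA.
Qed.

Lemma MPinverse_split_proj T : split_operator T ->
  MPinverse (split_proj T) \o (split_proj T \- T) =
  orth_proj (range (adjoint T)) \o (idfun \- T).
Proof.
move=> sT; have [bT clT _] := sT; have QP := split_projP sT.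
have bQ := is_proj_bounded QP.
have [bX [QXQ XQX _ hXQ]] := MPinverse_projP clT QP.
set Q := split_proj T in QP bQ bX QXQ XQX hXQ *.
set X := MPinverse Q in bX QXQ XQX hXQ *.
have XQ : X \o Q = orth_proj (range (adjoint T)).
  rewrite (hermitian_idempotentE (bounded_operator_comp bX bQ) hXQ); last first.
    by rewrite -[in RHS]XQX.
  (* [Q \o X \o Q = Q] keeps the kernel of [X \o Q] from growing beyond that of [Q]. *)
  congr orth_proj; have -> : kernel (X \o Q) = kernel T.
    case: QP => _ _ _ <-; apply/seteqP; split=> x; rewrite /kernel/= => Qx.
      by rewrite -[LHS](congr1 (@^~ x) QXQ) /= Qx (linear_map0 bQ.1).
    by rewrite Qx (linear_map0 bX.1).
  have bT' := (adjointP bT).1.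
  rewrite -[in kernel T](adjointK bT) kernel_adjoint// orth_complK//.
    exact: closed_range_adjoint.
  exact: subspace_range bT'.1.
apply/funext => x /=; rewrite -XQ /= (linear_mapB bX.1).
have -> : T x = Q (T x) by apply/esym/(is_proj_id QP); exists x.
rewrite [in RHS](linear_mapB bQ.1) (linear_mapB bX.1).
by rewrite [in RHS](is_proj_id QP (_ : range T (Q (T x))))//; exact: is_proj_range QP _.
Qed.

End SplitOperators.

Theorem proposition5p2 (R : realType) (H : hilbertType R) (T : H -> H)
    (splitT : split_operator T) :
  (opnorm (orth_proj (range (adjoint T)) \o (idfun \- T)) < 1 ->
     split_proper_splitting_converges T) /\
  (hermitian_operator (orth_proj (range (adjoint T)) \o T) ->
     split_proper_splitting_converges T ->
     opnorm (orth_proj (range (adjoint T)) \o (idfun \- T)) < 1).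
Proof.
have [bT clT _] := splitT; have QP := split_projP splitT.
have bQ := is_proj_bounded QP; have bP := is_proj_bounded (orth_proj_adjointP bT clT).
have bB := bounded_operator_comp bP (bounded_operatorB (@bounded_operator_id R H) bT).
split=> [B1|hPT [_]]; rewrite /split_proper_splitting_converges /proper_splitting_converges
  MPinverse_split_proj//.
  (* Convergence also includes being a proper splitting; the range and kernel conditions come with
     the projection. *)
  split; last exact: le_lt_trans (spectral_radius_le_opnorm bB) B1.
  split => //; split => //; first exact: bounded_operatorB.
  - by apply/funext => x /=; rewrite opprB addrC subrK.
  - by case: QP.
  - by case: QP.
apply: hermitian_opnorm_lt => //; apply/(hermitian_operatorP bB) => x y /=.
rewrite !(linear_mapB bP.1) hdotBl hdotBr; congr (_ - _).
  apply: orth_proj_sym; first exact: closed_range_adjoint.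
  exact: subspace_range (adjointP bT).1.1.
exact: (hermitian_operatorP (bounded_operator_comp bP bT)).1 hPT x y.
Qed.
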